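(* Let $X$, $Y$ be Banach spaces (over $\mathbb{K}=\mathbb{R}$ or $\mathbb{C}$) and let $G\in L(X,Y)$ be a norm-one bounded linear operator. If $G$ is lush, then $G$ is a Lipschitz spear operator, i.e. $$\sup_{\omega\in\mathbb{T}}\|G+\omega F\|_L=1+\|F\|_L$$ for every $F\in \operatorname{Lip}_0(X,Y)$.
   Context: $\mathbb{T}=\{\omega\in\mathbb{K}:|\omega|=1\}$; $B_X$, $S_X$ are the closed unit ball and unit sphere of $X$; $\operatorname{aconv}(F)=\operatorname{conv}(\mathbb{T}F)$. $\operatorname{Lip}_0(X,Y)$ is the Banach space of all (not necessarily linear) Lipschitz maps $F:X\to Y$ with $F(0)=0$, with norm $\|F\|_L=\sup\{\|F(x)-F(y)\|/\|x-y\|: x\neq y\in X\}$. Lush operator: a norm-one operator $G\in L(X,Y)$ is lush if for every $x_0\in B_X$, every $\varepsilon>0$ and every $y\in S_Y$ there is a set $F\subset B_X$ such that $\operatorname{conv}(F)\subset\{x\in B_X:\|Gx+y\|>2-\varepsilon\}$ and $\operatorname{dist}(x_0,\operatorname{aconv}(F))<\varepsilon$. *)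

(* Defs.v *)
From HB Require Import structures.
From mathcomp Require Import all_boot all_order all_algebra.
From mathcomp Require Import all_classical all_reals all_analysis.

Set Implicit Arguments.
Unset Strict Implicit.
Unset Printing Implicit Defensive.

Import Order.TTheory GRing.Theory Num.Theory.
Import numFieldNormedType.Exports.

Local Open Scope classical_set_scope.
Local Open Scope ring_scope.

(* The scalar field is a [K : numFieldType], to be instantiated with the real
   numbers [R : realType] or the complex numbers [R[i]].  As usual in this
   library, norms are elements of [K]; over [R[i]] the order is the partial one
   ([x <= y] iff [y - x] is a nonnegative real), so [0 <= t] and [0 < e] force
   [t] and [e] to be real.  For the same reason the library's [sup] and [inf],
   which are restricted to realType, are replaced by [supremum 0] and
   [infimum 0]: for a nonempty set of real scalars bounded above (resp. below),
   these are the usual real supremum and infimum, in both cases of [K]. *)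

Definition unit_circle (K : numFieldType) : set K := [set w | `|w| = 1].

Definition unit_ball (K : numFieldType) (X : normedModType K) : set X :=
  [set x | `|x| <= 1].

Definition unit_sphere (K : numFieldType) (X : normedModType K) : set X :=
  [set x | `|x| = 1].

Definition convex_hull (K : numFieldType) (X : lmodType K) (A : set X) : set X :=
  [set x | exists (n : nat) (t : 'I_n -> K) (a : 'I_n -> X),
     [/\ forall i, 0 <= t i,
         \sum_(i < n) t i = 1,
         forall i, A (a i)
       & x = \sum_(i < n) t i *: a i]].

Definition abs_convex_hull (K : numFieldType) (X : lmodType K) (A : set X) : set X :=
  convex_hull [set z | exists w a, [/\ unit_circle w, A a & z = w *: a]].

(* Only meaningful for nonempty [A]: the value is 0 when [A] is empty. *)
Definition dist_to_set (K : numFieldType) (X : normedModType K) (x : X) (A : set X)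
  : K := infimum 0 [set `|x - a| | a in A].

Definition opnorm (K : numFieldType) (X Y : normedModType K) (G : X -> Y) : K :=
  supremum 0 [set `|G x| | x in @unit_ball K X].

Definition lip_norm (K : numFieldType) (X Y : normedModType K) (F : X -> Y)
  : K :=
  supremum 0 [set r | exists x y, x != y /\ r = `|F x - F y| / `|x - y|].

Definition Lip0 (K : numFieldType) (X Y : normedModType K) : set (X -> Y) :=
  [set F | F 0 = 0 /\ lipschitz F].

(* [F !=set0] makes explicit that the distance to the empty set is +oo. *)
Definition lush (K : numFieldType) (X Y : normedModType K) (G : X -> Y) : Prop :=
  forall (x0 : X) (e : K) (y : Y),
    unit_ball x0 -> 0 < e -> unit_sphere y ->
    exists F : set X,
      [/\ F !=set0,
          F `<=` @unit_ball K X,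
          convex_hull F `<=` [set x | unit_ball x /\ 2 - e < `|G x + y|]
        & dist_to_set x0 (abs_convex_hull F) < e].

Definition lipschitz_spear (K : numFieldType) (X Y : normedModType K)
    (G : X -> Y) : Prop :=
  forall F : X -> Y, Lip0 F ->
    supremum 0 [set lip_norm (fun x => G x + w *: F x) | w in @unit_circle K] =
    1 + lip_norm F.

(* Main.v *)
Require Import Defs.
From HB Require Import structures.
From mathcomp Require Import all_boot all_order all_algebra.
From mathcomp Require Import all_classical all_reals all_analysis.
From mathcomp Require Import complex ring.

(* Given [x != y] at which [F] has slope close to [L = ||F||_L], put
   [r = |x - y|] and [F x - F y = |F x - F y| *: z] with [|z| = 1].  Lushness at
   [(x - y) / r] and [z] gives [t_i], [w_i], [a_i] such that
   [\sum t_i w_i a_i] is close to [(x - y) / r] and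
   [|G (\sum t_i a_i) + z| > 2 - e].  Walk from [y] to near [x] along the polygon
   with steps [r t_i w_i a_i].  If [M] bounds every [||G + w F||_L], the increment
   of [F] on the [i]-th step plus [r t_i G a_i] has norm at most [M r t_i]: up to
   the factor [w_i] it is the increment of [G + w_i F].  Summing over the steps,
   [|(F x - F y) / r + G (\sum t_i a_i)|], which is nearly [1 + L], is at most [M]
   up to small errors. *)

Set Implicit Arguments.
Unset Strict Implicit.
Unset Printing Implicit Defensive.

Import Order.TTheory GRing.Theory Num.Theory.
Import numFieldNormedType.Exports.

Local Open Scope classical_set_scope.
Local Open Scope ring_scope.
Local Open Scope complex_scope.

(* The form of completeness shared by [R] and the partially ordered [R[i]]. *)
Definition nonneg_sup_complete (K : numFieldType) : Prop :=
  forall A : set K, A !=set0 -> (forall a, A a -> 0 <= a) ->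
    ubound A !=set0 -> supremums A !=set0.

Lemma nonneg_sup_complete_real (R : realType) : nonneg_sup_complete R.
Proof.
move=> A A0 _ ubA; exists (sup A); split=> [a Aa|b ubb].
  exact: ub_le_sup.
exact: ge_sup.
Qed.

(** Nonnegative complex numbers have zero imaginary part, so the real supremum of the real parts
    serves. *)
Lemma nonneg_sup_complete_complex (R : realType) : nonneg_sup_complete R[i].
Proof.
move=> A [a0 Aa0] Age0 [z ubz].
have ImA a : A a -> complex.Im a = 0.
  by move=> /Age0; rewrite lecE => /andP[/eqP].
pose B := [set complex.Re a | a in A].
have B0 : B !=set0 by exists (complex.Re a0), a0.
have ubB : has_ubound B.
  exists (complex.Re z) => _ [a Aa <-].
  by have := ubz a Aa; rewrite lecE => /andP[].
exists (sup B)%:C; split=> [a Aa|b ubb].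
  rewrite lecE /= (ImA _ Aa) eqxx /=.
  by apply: ub_le_sup => //; exists a.
(* An upper bound [b] lies above [a0], so its imaginary part vanishes too. *)
have := ubb a0 Aa0; rewrite lecE (ImA _ Aa0) => /andP[/eqP Imb _].
rewrite lecE /= Imb eqxx /=.
apply: ge_sup => // _ [a Aa <-].
by have := ubb a Aa; rewrite lecE => /andP[].
Qed.

(** * Suprema and infima of sets of nonnegative scalars *)

Section Supremum.
Variables (K : numFieldType) (compK : nonneg_sup_complete K).
Implicit Types A : set K.

Lemma supremum_eq A s : A !=set0 -> supremums A s -> supremum 0 A = s.
Proof.
move=> /set0P/negbTE A0 sA; rewrite /supremum A0.
by apply: (@is_subset1_supremums _ _ A) => //; apply: xgetPex; exists s.
Qed.

Lemma supremums_supremum A :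
  A !=set0 -> (forall a, A a -> 0 <= a) -> ubound A !=set0 ->
  supremums A (supremum 0 A).
Proof.
by move=> A0 Age0 ubA; have [s sA] := compK A0 Age0 ubA; rewrite (supremum_eq A0 sA).
Qed.

Lemma supremums_adherent A s e :
  A !=set0 -> (forall a, A a -> 0 <= a) -> supremums A s -> 0 < e ->
  exists2 a, A a & s - e < a.
Proof.
move=> [a0 Aa0] Age0 [ubs leas] e0.
have sr : s \is Num.real.
  by rewrite ger0_real// (le_trans (Age0 _ Aa0))// ubs.
have er : e \is Num.real by rewrite gtr0_real.
apply/not_exists2P => noa.
have : s <= s - e.
  apply: leas => a Aa; rewrite real_leNgt ?realB ?(ger0_real (Age0 _ Aa))//.
  by apply/negP => sea; case: (noa a).
by rewrite lerBrDl gerDr real_leNgt// e0.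
Qed.

(** [compK] yields suprema only; the infimum is recovered as the supremum of the nonnegative lower
    bounds. *)
Lemma infimum_lt_mem A e :
  A !=set0 -> (forall a, A a -> 0 <= a) -> 0 < e -> infimum 0 A < e ->
  exists2 a, A a & a < e.
Proof.
move=> A0 Age0 e0; have [a0 Aa0] := A0.
pose B := [set b : K | 0 <= b /\ lbound A b].
have [s [ubs leas]] : supremums B !=set0.
  apply: compK; first by exists 0; split.
    by move=> b [].
  by exists a0 => b [_ /(_ _ Aa0)].
have infs : infimums A s.
  split=> [a Aa|c lbc]; first by apply: leas => b [_ /(_ _ Aa)].
  have s0 : 0 <= s by apply: ubs; split.
  (* The order of [K] may be partial: [c] is real because [a0 - c] is nonnegative, and so it can be
     compared with 0. *)
  have cr : c \is Num.real.
    rewrite -(subrK a0 c) -opprB realD ?realN ?(ger0_real (Age0 _ Aa0))//.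
    by rewrite ger0_real// subr_ge0 lbc.
  have [c0|/ltW c0] := real_leP (real0 K) cr; last exact: le_trans s0.
  by apply: ubs; split.
have -> : infimum 0 A = s.
  move: (A0) => /set0P/negbTE A0'; rewrite /infimum A0'.
  by apply: (@is_subset1_infimums _ _ A) => //; apply: xgetPex; exists s.
move=> se; apply/not_exists2P => noa.
have : e <= s.
  apply: infs.2 => a Aa; rewrite real_leNgt ?(gtr0_real e0) ?(ger0_real (Age0 _ Aa))//.
  by apply/negP => ae; case: (noa a).
by move=> es; have := le_lt_trans es se; rewrite ltxx.
Qed.

End Supremum.

(** * The Lipschitz norm as an actual supremum; [p != q] keeps the set of slopes nonempty *)

Section LipNorm.
Variables (K : numFieldType) (compK : nonneg_sup_complete K).
Variables (X Y : normedModType K).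
Variables (p q : X) (pq : p != q).

Let slopes (F : X -> Y) : set K :=
  [set r | exists x y, x != y /\ r = `|F x - F y| / `|x - y|].

Let slopes_neq0 F : slopes F !=set0.
Proof. by eexists; exists p, q. Qed.

Let slopes_ge0 F r : slopes F r -> 0 <= r.
Proof. by move=> [x [y [_ ->]]]; rewrite divr_ge0. Qed.

Variables (F : X -> Y) (C : K).
Hypothesis (FC : forall x y, `|F x - F y| <= C * `|x - y|).

Lemma supremums_lip_norm : supremums (slopes F) (lip_norm F).
Proof.
apply: supremums_supremum => //; first exact: slopes_ge0.
exists C => _ [x [y [xy ->]]].
by rewrite ler_pdivrMr// normr_gt0 subr_eq0.
Qed.

Lemma lip_norm_le : lip_norm F <= C.
Proof.
apply: supremums_lip_norm.2 => _ [x [y [xy ->]]].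
by rewrite ler_pdivrMr// normr_gt0 subr_eq0.
Qed.

Lemma lip_norm_ge0 : 0 <= lip_norm F.
Proof.
have [r Fr] := slopes_neq0 F.
by rewrite (le_trans (slopes_ge0 Fr))// supremums_lip_norm.1.
Qed.

Lemma lip_normP x y : `|F x - F y| <= lip_norm F * `|x - y|.
Proof.
have [->|xy] := eqVneq x y; first by rewrite !subrr !normr0 mulr0.
rewrite -ler_pdivrMr ?normr_gt0 ?subr_eq0//.
by apply: supremums_lip_norm.1; exists x, y.
Qed.

Lemma lip_norm_adherent e : 0 < e ->
  exists x y, x != y /\ lip_norm F - e < `|F x - F y| / `|x - y|.
Proof.
move=> e0.
have [_ [x [y [xy ->]]] lt] :=
  supremums_adherent (slopes_neq0 F) (@slopes_ge0 F) supremums_lip_norm e0.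
by exists x, y.
Qed.

End LipNorm.

(** * Bounds for Lipschitz maps and for operators of norm one *)

Lemma lipschitz_bound (K : numFieldType) (X Y : normedModType K) (F : X -> Y) :
  lipschitz F -> exists C, forall x y, `|F x - F y| <= C * `|x - y|.
Proof.
(* [lipschitz] says that all constants beyond some threshold [M] work; [|M| + 1] exceeds it. *)
move=> [M [Mr HM]]; exists (`|M| + 1) => x y; apply: (HM (`|M| + 1) _ (x, y)) => //.
by rewrite (le_lt_trans (real_ler_norm Mr))// ltrDl.
Qed.

(** The value 1 differs from the default 0 of [supremum], so it is a genuine least upper bound; the
    rest is scaling. *)
Lemma opnormP (K : numFieldType) (X Y : normedModType K) (G : {linear X -> Y}) :
  opnorm G = 1 -> forall x, `|G x| <= `|x|.
Proof.
rewrite /opnorm => G1.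
have supG : supremums [set `|G x| | x in @unit_ball K X] 1.
  move: G1; rewrite /supremum; case: ifP => _.
    by move=> /esym/eqP; rewrite oner_eq0.
  by case: xgetP => [? -> // + <-//|_ /esym/eqP]; rewrite oner_eq0.
move=> x; have [->|x0] := eqVneq x 0; first by rewrite linear0 !normr0.
have nx0 : 0 < `|x| by rewrite normr_gt0.
have : `|G (`|x|^-1 *: x)| <= 1.
  apply: supG.1; exists (`|x|^-1 *: x) => //.
  by rewrite /unit_ball /= normrZ normfV normr_id mulVf ?gt_eqF.
by rewrite linearZ normrZ normfV normr_id ler_pdivrMl// mulr1.
Qed.

(** Supplies a nonzero point of [X], so that slopes exist, and a nonzero vector of [Y], to be
    normalised. *)
Lemma opnorm_eq1_neq0 (K : numFieldType) (X Y : normedModType K) (G : {linear X -> Y}) :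
  opnorm G = 1 -> exists x, G x != 0.
Proof.
move=> G1; apply: contrapT => /forallNP G0.
have {}G0 x : G x = 0 by apply/eqP; apply: contrapT => /negP; exact: G0.
move: G1; rewrite /opnorm.
have -> : [set `|G x| | x in @unit_ball K X] = [set 0].
  apply/seteqP; split => [_ [x _ <-]|_ ->] /=; first by rewrite G0 normr0.
  by exists 0; rewrite ?G0 /unit_ball /= ?normr0.
by rewrite supremum1 => /esym/eqP; rewrite oner_eq0.
Qed.


Lemma ler_norm_scaled_add (K : numFieldType) (Y : normedModType K) (z g : Y) (l e : K) :
  `|z| = 1 -> `|g| <= 1 -> 0 <= l -> 2 - e < `|g + z| ->
  (1 + l) * (1 - e) <= `|l *: z + g|.
Proof.
move=> z1 g1 l0 gz; have l1 : 0 < 1 + l by rewrite ltr_pwDl.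
have -> : (1 + l) * (1 - e) = (1 + l) * (2 - e) - (1 + l) by ring.
(* [(1 + l)(g + z)] is the sum of [l z + g] and of [z + l g], of norm at most [1 + l]. *)
rewrite lerBlDr (le_trans (ler_wpM2l (ltW l1) (ltW gz)))//.
have -> : (1 + l) * `|g + z| = `|(l *: z + g) + (z + l *: g)|.
  rewrite -{1}(gtr0_norm l1) -normrZ scalerDl scale1r scalerDr.
  by rewrite addrC [l *: g + _]addrC addrACA [l *: g + z]addrC.
rewrite (le_trans (ler_normD _ _))// lerD2l (le_trans (ler_normD _ _))//.
by rewrite z1 lerD2l normrZ ger0_norm// ler_piMr.
Qed.

(** * Increments of [F] along a polygon *)

Section PolygonIncrement.
Variables (K : numFieldType) (X Y : normedModType K) (G : {linear X -> Y}).
Variables (F : X -> Y) (M : K).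
Hypothesis M_ge0 : 0 <= M.
Hypothesis HM : forall w x y, `|w| = 1 ->
  `|(G x + w *: F x) - (G y + w *: F y)| <= M * `|x - y|.

Lemma step_increment (t w : K) (a y : X) : 0 <= t -> `|w| = 1 -> `|a| <= 1 ->
  `|F (y + t *: (w *: a)) - F y + G (t *: a)| <= M * t.
Proof.
move=> t0 w1 a1; set p := y + _.
have py : p - y = t *: (w *: a) by rewrite /p addrAC subrr add0r.
have -> : `|F p - F y + G (t *: a)| = `|(G p + w *: F p) - (G y + w *: F y)|.
  (* Multiplying by the unimodular [w] keeps the norm and turns [G (t *: a)] into [G (p - y)]. *)
  rewrite -[LHS]mul1r -w1 -normrZ scalerDr scalerBr -linearZ/= scalerA mulrC -scalerA.
  by rewrite opprD addrACA -(linearB G) py addrC.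
rewrite (le_trans (HM _ _ w1))// ler_wpM2l// py !normrZ w1 mul1r ger0_norm//.
by rewrite ler_piMr.
Qed.

Lemma polygon_increment n (t w : 'I_n -> K) (a : 'I_n -> X) (y : X) :
  (forall i, 0 <= t i) -> (forall i, `|w i| = 1) -> (forall i, `|a i| <= 1) ->
  `|F (y + \sum_i t i *: (w i *: a i)) - F y + G (\sum_i t i *: a i)|
    <= M * \sum_i t i.
Proof.
elim: n t w a => [|n IHn] t w a t0 w1 a1.
  by rewrite !big_ord0 addr0 linear0 subrr addr0 normr0 mulr0.
rewrite !big_ord_recr /= addrA.
set v := y + _; set u := v + _.
(* Insert [F v]: the last step starts at [v], the endpoint of the first [n] steps. *)
rewrite mulrDr linearD/= -[F u - F y](subrKA (F v)) [F u - _ + _]addrC addrACA.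
rewrite (le_trans (ler_normD _ _))// lerD//; first exact: IHn.
exact: step_increment.
Qed.

End PolygonIncrement.

(** * From lushness to the spear identity *)

Section LushSpear.
Variables (K : numFieldType) (compK : nonneg_sup_complete K).
Variables (X Y : normedModType K) (G : {linear X -> Y}).
Hypotheses (G1 : opnorm G = 1) (lushG : lush G).

Lemma unit_direction (v : Y) : exists2 z : Y, `|z| = 1 & v = `|v| *: z.
Proof.
have unit (b : Y) : b != 0 -> `| `|b|^-1 *: b| = 1.
  by move=> b0; rewrite normrZ normfV normr_id mulVf ?normr_eq0.
have [->|v0] := eqVneq v 0; last first.
  exists (`|v|^-1 *: v); first exact: unit.
  by rewrite scalerA divff ?normr_eq0// scale1r.
(* For [v = 0] any unit vector of [Y] will do. *)
have [x Gx0] := opnorm_eq1_neq0 G1.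
by exists (`|G x|^-1 *: G x); [exact: unit|rewrite normr0 scale0r].
Qed.

(** The same weights and points are used twice: rotated by [w] they approximate [x0]; unrotated they
    give a point of the convex hull on which lushness bounds the norm from below. *)
Lemma lush_combination (x0 : X) (z : Y) (e : K) : `|x0| <= 1 -> `|z| = 1 -> 0 < e ->
  exists n (t w : 'I_n -> K) (a : 'I_n -> X),
    [/\ (forall i, 0 <= t i) /\ \sum_i t i = 1, forall i, `|w i| = 1,
        forall i, `|a i| <= 1,
        `|x0 - \sum_i t i *: (w i *: a i)| < e &
        `|\sum_i t i *: a i| <= 1 /\ 2 - e < `|G (\sum_i t i *: a i) + z| ].
Proof.
move=> x01 z1 e0; have [A [A0 A1 convA distA]] := lushG x01 e0 z1.
have [||d [v [n [t [b [t0 t1 Ab ->]]]] <-] lte] := infimum_lt_mem compK _ _ e0 distA.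
(* The set of distances is nonempty: a point of [A], with rotation 1, is in the absolutely convex
   hull. *)
- have [a Aa] := A0; exists `|x0 - a|, a => //.
  exists 1%N, (fun=> 1), (fun=> a); split=> //; first by rewrite big_ord1.
    by move=> _; exists 1, a; split; rewrite /unit_circle /= ?normr1 ?scale1r.
  by rewrite big_ord1 scale1r.
- by move=> _ [v _ <-].
have [w Hw] := choice Ab; have [a Ha] := choice Hw.
exists n, t, w, a; split=> //.
- by move=> i; have [] := Ha i.
- by move=> i; have [_ /A1] := Ha i.
- by under eq_bigr => i _ do (have [_ _ <-] := Ha i).
- by apply: convA; exists n, t, a; split=> // i; have [] := Ha i.
Qed.

(** The endpoint [y + r *: v] misses [x] by at most [r * e], which costs [L * e] after division by
    [r]; the factor [1 - e] comes from [ler_norm_scaled_add]. *)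
Lemma lush_slope_le (F : X -> Y) (L M e : K) (x y : X) :
  0 <= M -> (forall w x y, `|w| = 1 ->
    `|(G x + w *: F x) - (G y + w *: F y)| <= M * `|x - y|) ->
  (forall x y, `|F x - F y| <= L * `|x - y|) ->
  x != y -> 0 < e ->
  (1 + `|F x - F y| / `|x - y|) * (1 - e) <= M + L * e.
Proof.
move=> M0 HM HL xy e0.
have r0 : 0 < `|x - y| by rewrite normr_gt0 subr_eq0.
set r := `|x - y| in r0 *.
have L0 : 0 <= L.
  by rewrite -(pmulr_lge0 _ r0); exact: le_trans (HL x y).
have [z z1 Fz] := unit_direction (F x - F y).
have u1 : `|r^-1 *: (x - y)| <= 1.
  by rewrite normrZ normfV normr_id mulVf ?gt_eqF.
have [n [t [w [a [[t0 t1] w1 a1 uv [A1 GA]]]]]] := lush_combination u1 z1 e0.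
set v := \sum_i t i *: (w i *: a i) in uv; set A := \sum_i t i *: a i in A1 GA.
have l0 : 0 <= `|F x - F y| / r by rewrite divr_ge0// ltW.
apply: le_trans (ler_norm_scaled_add z1 (le_trans (opnormP G1 A) A1) l0 GA) _.
rewrite -(ler_pM2l r0) -[X in X * _ <= _](gtr0_norm r0) -normrZ scalerDr scalerA.
rewrite mulrCA divff ?gt_eqF// mulr1 -Fz.
have poly : `|F (y + r *: v) - F y + r *: G A| <= r * M.
  have rt0 i : 0 <= r * t i by rewrite mulr_ge0// ltW.
  have := polygon_increment M0 HM y rt0 w1 a1.
  rewrite -mulr_sumr t1 mulr1 mulrC.
  under eq_bigr do rewrite -scalerA.
  under [X in G X]eq_bigr do rewrite -scalerA.
  by rewrite -!scaler_sumr linearZ.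
rewrite mulrDr -[F x - F y](subrKA (F (y + r *: v))) -addrA addrC.
rewrite (le_trans (ler_normD _ _))// lerD//.
rewrite (le_trans (HL _ _))// mulrCA ler_wpM2l//.
have -> : x - (y + r *: v) = r *: (r^-1 *: (x - y) - v).
  by rewrite scalerBr scalerA divff ?gt_eqF// scale1r opprD addrA.
by rewrite normrZ gtr0_norm// ler_pM2l// ltW.
Qed.

Lemma lush_lipschitz_spear : lipschitz_spear G.
Proof.
move=> F [_ /lipschitz_bound[C FC]].
have [p Gp0] := opnorm_eq1_neq0 G1.
have p0 : p != 0 by apply: contra Gp0 => /eqP ->; rewrite linear0.
set L := lip_norm F.
have L0 : 0 <= L := lip_norm_ge0 compK p0 FC.
have FL x y : `|F x - F y| <= L * `|x - y| := lip_normP compK p0 FC x y.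
have GwF w : `|w| = 1 -> forall x y,
    `|(G x + w *: F x) - (G y + w *: F y)| <= (1 + L) * `|x - y|.
  move=> w1 x y; rewrite opprD addrACA -(linearB G) -scalerBr mulrDl mul1r.
  rewrite (le_trans (ler_normD _ _))// lerD// ?opnormP//.
  by rewrite normrZ w1 mul1r.
(* [1 + L] is an upper bound by [GwF]; the work is to show that every upper bound [M] is at least
   [1 + L]. *)
apply: supremum_eq.
  by eexists; exists 1 => //; rewrite /unit_circle /= normr1.
split=> [_ [w w1 <-]|M ubM].
  by apply: (lip_norm_le compK p0); exact: GwF.
have lM w : `|w| = 1 -> lip_norm (fun x => G x + w *: F x) <= M.
  by move=> w1; apply: ubM; exists w.
have M0 : 0 <= M.
  by apply: le_trans (lM 1 (normr1 _)); exact: (lip_norm_ge0 compK p0 (GwF 1 (normr1 _))).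
have HM w x y : `|w| = 1 ->
    `|(G x + w *: F x) - (G y + w *: F y)| <= M * `|x - y|.
  move=> w1; apply: le_trans (lip_normP compK p0 (GwF w w1) x y) _.
  by rewrite ler_wpM2r// lM.
apply/ler_addgt0Pr => e e0.
have L2 : 0 < 2 * (1 + L) by rewrite mulr_gt0// ltr_pwDl.
(* Three errors add up to [e]: [d] from the choice of [x] and [y], [L * d] from [lush_slope_le], and
   [(1 + L) * d] from its factor [1 - d], as the slope is at most [L]. *)
pose d := e / (2 * (1 + L)).
have d0 : 0 < d by rewrite divr_gt0.
have [x [y [xy ltl]]] := lip_norm_adherent compK p0 FC d0.
have := lush_slope_le M0 HM FL xy d0.
set l := _ / _ in ltl *; move=> main.
have lL : l <= L by rewrite ler_pdivrMr ?normr_gt0 ?subr_eq0.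
have -> : e = d + L * d + (1 + L) * d.
  rewrite -[e](divfK (lt0r_neq0 L2)) -/d; ring.
have : 1 + l <= M + L * d + (1 + L) * d.
  have -> : 1 + l = (1 + l) * (1 - d) + (1 + l) * d by ring.
  by rewrite lerD// ler_wpM2r ?(ltW d0)// lerD2l.
move=> H; have -> : M + (d + L * d + (1 + L) * d) = d + (M + L * d + (1 + L) * d) by ring.
by rewrite -lerBlDl (le_trans _ H)// -addrA lerD2l ltW.
Qed.

End LushSpear.

Theorem corollary7p5 (R : realType) :
  (forall (X Y : completeNormedModType R) (G : {linear X -> Y}),
     continuous G -> opnorm G = 1 -> lush G -> lipschitz_spear G)
  /\
  (forall (X Y : completeNormedModType R[i]) (G : {linear X -> Y}),
     continuous G -> opnorm G = 1 -> lush G -> lipschitz_spear G).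
Proof.
split=> X Y G _ G1 lushG; apply: lush_lipschitz_spear => //.
- exact: nonneg_sup_complete_real.
- exact: nonneg_sup_complete_complex.
Qed.
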